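(* For all $n\ge 1$ and $t\ge 0$, the sequence of numbers $(v_t(n,0),v_t(n,1),\ldots,v_t(n,n-1))$ is unimodal.
   Context: $\mathfrak{S}_n$ is the set of permutations of $\{1,\ldots,n\}$, written as words; $\mathrm{id}=12\cdots n$; $\mathrm{des}(\pi)$ is the number of indices $j$ with $\pi_j>\pi_{j+1}$. The operator $\mathcal{T}$ (revstack sort) is defined recursively on finite words of distinct positive integers by $\mathcal{T}(\epsilon)=\epsilon$ for the empty word $\epsilon$, $\mathcal{T}(x)=x$ for a word $x$ of length 1, and $\mathcal{T}(LmR)=\mathcal{T}(R)\,\mathcal{T}(L)\,m$, where $m$ is the largest entry of $LmR$; $\mathcal{T}^t$ is its $t$-fold iterate (the identity map for $t=0$). $v_t(n,i)$ is the number of $\pi\in\mathfrak{S}_n$ with $\mathrm{des}(\pi)=i$ and $\mathcal{T}^t(\pi)=\mathrm{id}$. A finite sequence is unimodal if it is weakly increasing up to some index and weakly decreasing from that index on. *)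

(* Defs.v *)
From mathcomp Require Import all_boot.

Set Implicit Arguments.
Unset Strict Implicit.
Unset Printing Implicit Defensive.

(* Words are lists of natural numbers. *)
Definition word := seq nat.

Definition maxw (w : word) : nat := \max_(x <- w) x.

(* The fuel only serves to make the recursion structural: [revstack] starts
   it at the length of the word, and [revstack_cat] below shows that it then
   satisfies the recursion T(LmR) = T(R) T(L) m. *)
Fixpoint revstack_rec (fuel : nat) (w : word) : word :=
  match fuel, w with
  | f.+1, _ :: _ =>
      let m := maxw w in
      let k := index m w in
      revstack_rec f (drop k.+1 w) ++ revstack_rec f (take k w) ++ [:: m]
  | _, _ => [::]
  end.

Definition revstack (w : word) : word := revstack_rec (size w) w.

Definition des (w : word) : nat :=
  count (fun j => nth 0 w j > nth 0 w j.+1) (iota 0 (size w).-1).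

(* [permutations (iota 1 n)] lists, without repetition, all the rearrangements
   of the word 12...n. *)
Definition v (t n i : nat) : nat :=
  count (fun w => (des w == i) && (iter t revstack w == iota 1 n))
        (permutations (iota 1 n)).

(* The two pieces overlap in the entry of index k (indices start at 0). *)
Definition unimodal (s : seq nat) : Prop :=
  exists2 k, k < size s &
    sorted leq (take k.+1 s) /\ sorted geq (drop k s).

Lemma maxw_in x w : maxw (x :: w) \in x :: w.
Proof.
rewrite /maxw; elim: w x => [|y w IH] x; first by rewrite big_seq1 inE.
rewrite big_cons /maxn; case: ifP => _; last by rewrite inE eqxx.
by rewrite inE IH orbT.
Qed.

Lemma revstack_rec_fuel f w : size w <= f -> revstack_rec f w = revstack w.
Proof.
have [k] := ubnP (size w); elim: k f w => // k IH [|f] [|x w] //= lek lef.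
rewrite /revstack /=; set m := maxw _; set i := if _ then _ else _.
have Di : i = index m (x :: w) by [].
have ilt : i < size (x :: w) by rewrite Di index_mem maxw_in.
have sL : size (take i (x :: w)) <= size w by rewrite size_take ilt -ltnS.
have sR : size (drop i w) <= size w by rewrite size_drop leq_subr.
have lt_k u : size u <= size w -> size u < k.
  by move=> le_u; apply: leq_ltn_trans le_u _.
have E u g : size u <= size w -> size w <= g -> revstack_rec g u = revstack u.
  by move=> le_u le_g; apply: IH; [exact: lt_k | exact: leq_trans le_g].
by rewrite !(E _ f) // !(E _ (size w)).
Qed.

Lemma revstack_nil : revstack [::] = [::].
Proof. by []. Qed.

Lemma revstack_seq1 x : revstack [:: x] = [:: x].
Proof. by rewrite /revstack /= /maxw big_seq1. Qed.

Lemma revstack_cat L m R :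
  all (ltn^~ m) L -> all (ltn^~ m) R ->
  revstack (L ++ m :: R) = revstack R ++ revstack L ++ [:: m].
Proof.
move=> ltL ltR; set w := L ++ m :: R.
have Dm : maxw w = m.
  apply/eqP; rewrite eqn_leq /maxw; apply/andP; split.
    rewrite big_seq; apply: (big_ind (fun x => x <= m)) => // [a b lea leb|x].
      by rewrite geq_max lea.
    rewrite mem_cat inE => /or3P[/(allP ltL)/ltnW|/eqP->|/(allP ltR)/ltnW] //.
  by apply: leq_bigmax_seq => //; rewrite mem_cat mem_head orbT.
have mL : m \notin L by apply/negP => /(allP ltL); rewrite /= ltnn.
have Di : index m w = size L.
  by rewrite index_cat (negPf mL) /= eqxx addn0.
have sw : size w = (size L + size R).+1 by rewrite size_cat addnS.
have -> : revstack w = revstack_rec (size L + size R).+1 w by rewrite -sw.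
have Ew : w = head 0 w :: behead w by move: sw; case: (w).
have -> : revstack_rec (size L + size R).+1 w =
   revstack_rec (size L + size R) (drop (index (maxw w) w).+1 w) ++
   revstack_rec (size L + size R) (take (index (maxw w) w) w) ++ [:: maxw w].
  by rewrite Ew.
rewrite Dm Di {2}/w take_size_cat // /w -cat_rcons drop_size_cat ?size_rcons //.
by rewrite !revstack_rec_fuel // (leq_addl, leq_addr).
Qed.

(* Main.v *)
Require Import Defs.
From mathcomp Require Import all_boot all_algebra zify.

(** Let D_u be the polynomial summing q^(des w) over the words w with T(w) = u.
    Cutting w = LmR at its maximum, T(w) = T(R) T(L) m says that m is the last
    letter of u and that T(R), T(L) are a prefix and the complementary suffix of
    the word u' left by removing m.  Since des(LmR) = des L if R is empty and
    des L + 1 + des R otherwise (L never creates a descent with m), cutting a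
    nonempty u' in all possible ways gives, when m exceeds the letters of u',

      D_{u'm} = (1 + q) D_{u'} + q * sum of D_a D_b over u' = ab, a, b nonempty,

    where 1 + q accounts for the two cuts with an empty part ([fiber_rcons],
    [desgf_fiber_rcons]).

    For u nonempty with distinct letters, D_u is zero if the last letter of u
    is not its maximum, so by induction D_u is always a sum of polynomials
    q^j (1+q)^(d-2j) with d = |u| - 1: the factor 1 + q raises d by one, the
    factor q raises it by two, and d is additive on products.  This is gamma-positivity ([gamma_positive_fiber]).
    Such polynomials have coefficients that are symmetric about d/2 and increase
    up to the middle, and the class is closed under sums for a fixed d.

    For t > 0, the condition T^t(w) = id depends on w only through u = T(w), so
    the descent polynomial of the permutations satisfying it is the sum of D_u
    over the permutations u with T^(t-1)(u) = id, all with d = n - 1; it is thus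
    symmetric and unimodal.  For t = 0 only the identity is counted, which gives
    the sequence 1, 0, ..., 0. *)

Set Implicit Arguments.
Unset Strict Implicit.
Unset Printing Implicit Defensive.

(** * Gamma-positive polynomials *)

(** The polynomials that are nonnegative combinations of the
    q^j (1+q)^(d-2j), 2j <= d.  Generating them by the two factors, rather than
    giving the coefficients, turns closure under products and unimodality into
    inductions. *)
Inductive gamma_positive : nat -> {poly nat} -> Prop :=
| gamma_positive0 d : gamma_positive d 0%R
| gamma_positive1 : gamma_positive 0 1%R
| gamma_positiveD d p q :
    gamma_positive d p -> gamma_positive d q -> gamma_positive d (p + q)%R
| gamma_positiveX d p : gamma_positive d p -> gamma_positive d.+2 ('X * p)%R
| gamma_positive1X d p :
    gamma_positive d p -> gamma_positive d.+1 ((1 + 'X) * p)%R.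

Lemma gamma_positiveM d e p q :
  gamma_positive d p -> gamma_positive e q -> gamma_positive (d + e) (p * q)%R.
Proof.
move=> gp gq; elim: gp => {d p} [d||d p1 p2 _ IH1 _ IH2|d p _ IH|d p _ IH].
- by rewrite GRing.mul0r; constructor.
- by rewrite GRing.mul1r.
- by rewrite GRing.mulrDl; constructor.
- by rewrite -GRing.mulrA; constructor.
- by rewrite -GRing.mulrA; constructor.
Qed.

Lemma gamma_positive_sum (I : eqType) (r : seq I) (P : pred I) d
    (F : I -> {poly nat}) :
  (forall i, i \in r -> P i -> gamma_positive d (F i)) ->
  gamma_positive d (\sum_(i <- r | P i) F i)%R.
Proof.
move=> gF; rewrite big_seq_cond; apply: big_ind => [|p q|i /andP[ri Pi]].
- exact: gamma_positive0.
- exact: gamma_positiveD.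
- exact: gF.
Qed.

(** Symmetry has to be carried along with the monotonicity: multiplying by
    1 + q, the inequality at the middle index compares coefficients on both
    sides of the centre, which only symmetry relates. *)
Lemma gamma_positive_coef d (p : {poly nat}) :
  gamma_positive d p ->
  [/\ forall i, d < i -> (p`_i)%R = 0,
      forall i j, i + j = d -> (p`_i)%R = (p`_j)%R
    & forall i, i.*2 < d -> (p`_i)%R <= (p`_i.+1)%R].
Proof.
elim=> {d p} [d||d p q _ [p0 ps pu] _ [q0 qs qu]|d p _ [p0 ps pu]
             |d p _ [p0 ps pu]].
- by split=> [i|i j|i]; rewrite ?coef0.
- split=> [[|i]|i j|//]; rewrite ?coef1 //.
  by move=> /eqP; rewrite addn_eq0 => /andP[/eqP-> /eqP->].
- split=> [i di|i j ij|i di]; rewrite !coefD.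
  + by rewrite p0 ?q0.
  + by rewrite (ps _ _ ij) (qs _ _ ij).
  + by rewrite leq_add ?pu ?qu.
- split=> [[|i] // di|i j ij|i di]; rewrite ?coefXM /=.
  + by apply: p0; lia.
  + case: i j ij => [|i] [|j] //= ij.
    * by rewrite p0 //; lia.
    * by rewrite p0 //; lia.
    * by apply: ps; lia.
  + by case: i di => [|i] di //=; apply: pu; lia.
have E i : (((1 + 'X) * p)`_i)%R
    = (p`_i)%R + (if i is i'.+1 then (p`_i')%R else 0).
  by rewrite GRing.mulrDl GRing.mul1r coefD coefXM; case: i.
split=> [[|i] // di|i j ij|i di]; rewrite !E.
- by rewrite !p0 //; lia.
- case: i j ij => [|i] [|j] //= ij.
  + by rewrite (p0 j.+1) ?(ps 0 j) ?addn0 //; lia.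
  + by rewrite (p0 i.+1) ?(ps i 0) ?addn0 //; lia.
  + by rewrite addnC; congr (_ + _); apply: ps; lia.
- rewrite addnC leq_add2r; case: i di => [//|i] di.
  have [di'|di'] := ltnP i.+1.*2 d.
    by apply: leq_trans (pu i _) (pu _ di'); lia.
  by rewrite (ps i i.+2) //; lia.
Qed.

Lemma gamma_positive_unimodal d (p : {poly nat}) :
  gamma_positive d p -> unimodal [seq (p`_i)%R | i <- iota 0 d.+1].
Proof.
move=> /gamma_positive_coef[_ ps pu].
have sz : size [seq (p`_i)%R | i <- iota 0 d.+1] = d.+1.
  by rewrite size_map size_iota.
have nthE i : i <= d -> nth 0 [seq (p`_i)%R | i <- iota 0 d.+1] i = (p`_i)%R.
  by move=> id; rewrite (nth_map 0) ?size_iota // nth_iota.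
exists d./2; first by rewrite sz; lia.
split; apply/(sortedP 0) => i.
  rewrite size_take sz => lt_i; rewrite !nth_take ?nthE.
  all: try by move: lt_i; case: ifP; lia.
  by apply: pu; move: lt_i; case: ifP; lia.
rewrite size_drop sz => lt_i; rewrite !nth_drop !nthE; try lia.
rewrite /geq /= (ps (d./2 + i) (d - (d./2 + i))); last lia.
rewrite (ps (d./2 + i.+1) (d - (d./2 + i.+1))); last lia.
have -> : d - (d./2 + i) = (d - (d./2 + i.+1)).+1 by lia.
by apply: pu; lia.
Qed.

(** * Descents *)

Lemma des_cons2 x y w : des [:: x, y & w] = (y < x) + des (y :: w).
Proof. by rewrite /des /= (iotaDl 1 0) count_map. Qed.

Lemma des_cat_max L m R :
  all (ltn^~ m) L -> all (ltn^~ m) R ->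
  des (L ++ m :: R) = des L + (if R is [::] then 0 else (des R).+1).
Proof.
move=> + ltR; elim: L => [_|x [|y L] IH].
- by case: R ltR => [//|y R] /= /andP[ym _]; rewrite des_cons2 ym.
- move=> /= /andP[xm _]; have /= {}IH := IH isT.
  by rewrite des_cons2 IH /= ltnNge (ltnW xm).
- by move=> /andP[_ ltL]; have /= {}IH := IH ltL; rewrite !des_cons2 IH addnA.
Qed.

Lemma des_iota m n : des (iota m n) = 0.
Proof.
elim: n m => [//|[//|n] IH] m.
by have /= := IH m.+1; rewrite des_cons2 => ->; rewrite ltnNge leqnSn.
Qed.

(** * Fibres of the revstack operator *)

Lemma revstackE w (m := maxw w) (k := index m w) :
  0 < size w ->
  revstack w = revstack (drop k.+1 w) ++ revstack (take k w) ++ [:: m].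
Proof.
case: w @m @k => [//|x w] m k _.
have lt_k : k < size (x :: w) by rewrite index_mem maxw_in.
rewrite [LHS]/revstack [size _]/= [LHS]/= -/m -/(index m (x :: w)) -/k.
rewrite !revstack_rec_fuel //.
all: by rewrite ?size_take ?size_drop ?lt_k //= ?leq_subr -?ltnS.
Qed.

Lemma perm_revstack w : perm_eq (revstack w) w.
Proof.
have [n] := ubnP (size w); elim: n w => // n IH [//|x w] lt_n.
rewrite revstackE //; set m := maxw _; set k := index _ _.
have mw : m \in x :: w by exact: maxw_in.
have lt_k : k < size (x :: w) by rewrite index_mem.
have E : x :: w = take k (x :: w) ++ m :: drop k.+1 (x :: w).
  by rewrite -{1}(cat_take_drop k (x :: w)) (drop_nth 0) // nth_index.
rewrite [X in perm_eq _ X]E perm_catC -catA perm_cat //.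
  by apply: IH; rewrite size_take lt_k; lia.
by rewrite /= perm_cons; apply: IH; rewrite size_drop /=; move: lt_n => /=; lia.
Qed.

Definition fiber (u : word) : seq word :=
  [seq w <- permutations u | revstack w == u].

Lemma mem_fiber u w : (w \in fiber u) = (revstack w == u).
Proof.
rewrite mem_filter mem_permutations andb_idr // => /eqP<-.
by rewrite perm_sym perm_revstack.
Qed.

Lemma fiber_uniq u : uniq (fiber u).
Proof. by rewrite filter_uniq // permutations_uniq. Qed.

Lemma all_fiber (a : pred nat) u w : w \in fiber u -> all a w = all a u.
Proof.
by rewrite mem_fiber => /eqP<-; rewrite (perm_all _ (perm_revstack w)).
Qed.

(** The words LmR in the fibre of u'm are classified by the length k of R,
    which tells where T(R) T(L) = u' is to be cut. *)
Lemma fiber_rcons u m :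
  all (ltn^~ m) u ->
  perm_eq (fiber (rcons u m))
    [seq p.1 ++ m :: p.2 | k <- iota 0 (size u).+1,
       p <- [seq (L, R) | L <- fiber (drop k u), R <- fiber (take k u)]].
Proof.
move=> lt_u.
have ltt k : all (ltn^~ m) (take k u).
  by apply/allP => x /mem_take; apply: (allP lt_u).
have ltd k : all (ltn^~ m) (drop k u).
  by apply/allP => x /mem_drop; apply: (allP lt_u).
apply: uniq_perm; first exact: fiber_uniq.
  apply: allpairs_uniq_dep => [|k _|].
  - exact: iota_uniq.
  - by rewrite allpairs_uniq ?fiber_uniq // => -[? ?] [? ?] _ _ [-> ->].
  (* L is recovered from LmR since m does not occur in L, and k is the
     length of R. *)
  move=> x y /allpairsPdep[k [p [kI pI ->]]].
  move=> /allpairsPdep[k' [p' [kI' pI' ->]]].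
  case/allpairsP: pI => -[L R] /= [LI RI ->].
  case/allpairsP: pI' => -[L' R'] /= [LI' RI' ->].
  have notin_L j M : M \in fiber (drop j u) -> m \notin M.
    move=> MI; apply/negP => mM; move: (ltd j).
    by rewrite -(all_fiber _ MI) => /allP/(_ _ mM); rewrite /= ltnn.
  have size_R j N : j \in iota 0 (size u).+1 ->
      N \in fiber (take j u) -> j = size N.
    rewrite mem_iota add0n ltnS mem_fiber => /= le_j /eqP EN.
    by rewrite -(perm_size (perm_revstack N)) EN size_takel.
  move=> E; have szL : size L = size L'.
    have := congr1 (index m) E; rewrite !index_cat /= eqxx !addn0.
    by rewrite (negPf (notin_L _ _ LI)) (negPf (notin_L _ _ LI')).
  move/eqP: E; rewrite eqseq_cat // eqseq_cons => /and3P[/eqP EL _ /eqP ER].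
  by rewrite (size_R _ _ kI RI) (size_R _ _ kI' RI') EL ER.
move=> w; rewrite mem_fiber; apply/eqP/allpairsPdep.
  move=> Ew; have pw : perm_eq w (rcons u m).
    by rewrite -Ew perm_sym perm_revstack.
  have mw : m \in w by rewrite (perm_mem pw) mem_rcons mem_head.
  case/splitPr: mw pw Ew => L R pLR.
  have {pLR} lt_LR : all (ltn^~ m) (L ++ R).
    rewrite (perm_all _ (s2 := u)) // -(perm_cons m).
    by rewrite perm_sym -perm_rcons -(permPl pLR) -cat1s perm_catCA.
  move: lt_LR; rewrite all_cat => /andP[lt_L lt_R].
  rewrite revstack_cat // catA cats1 => /rcons_inj[Eu].
  exists (size (revstack R)), (L, R); split=> //.
    by rewrite mem_iota add0n ltnS -Eu size_cat leq_addr.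
  apply/allpairsP; exists (L, R); split=> //=; rewrite mem_fiber -Eu.
    by rewrite drop_size_cat.
  by rewrite take_size_cat.
move=> [k [_ [kI /allpairsP[[L R] /= [LI RI ->]] ->]]] /=.
rewrite revstack_cat ?(all_fiber _ LI) ?(all_fiber _ RI) //.
move: LI RI; rewrite !mem_fiber => /eqP-> /eqP->.
by rewrite catA cat_take_drop cats1.
Qed.

Definition desgf (s : seq word) : {poly nat} := (\sum_(w <- s) 'X^(des w))%R.

Lemma desgf_fiber_nil : desgf (fiber [::]) = 1%R.
Proof.
by rewrite /desgf big_seq1.
Qed.

Lemma coef_desgf s i : ((desgf s)`_i)%R = count (fun w => des w == i) s.
Proof.
rewrite coef_sum -sum1_count [RHS]big_mkcond /=.
by apply: eq_bigr => w _; rewrite coefXn eq_sym; case: eqP.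
Qed.

(** The terms k = 0 and k = |u| of [fiber_rcons] give 1 and q times the
    polynomial of u, and each other cut gives a product with a factor q, the
    descent from m to the first letter of R. *)
Lemma desgf_fiber_rcons u m :
  0 < size u -> all (ltn^~ m) u ->
  desgf (fiber (rcons u m)) =
    ((1 + 'X) * desgf (fiber u)
     + \sum_(k <- iota 1 (size u).-1)
         'X * (desgf (fiber (drop k u)) * desgf (fiber (take k u))))%R.
Proof.
case: u => [//|x u'] _; set u := x :: u' => lt_u.
rewrite [LHS]/desgf (perm_big _ (fiber_rcons lt_u)) big_allpairs_dep.
have termE k : k <= size u ->
    (\sum_(p <- [seq (L, R) | L <- fiber (drop k u), R <- fiber (take k u)])
       'X^(des (p.1 ++ m :: p.2)))%R
    = ((if k == 0 then 1 else 'X)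
       * (desgf (fiber (drop k u)) * desgf (fiber (take k u))))%R :> {poly nat}.
  move=> le_k; rewrite big_allpairs GRing.mulr_suml GRing.mulr_sumr.
  apply: eq_big_seq => L LI; rewrite !GRing.mulr_sumr.
  apply: eq_big_seq => R RI.
  have lt_L : all (ltn^~ m) L.
    by rewrite (all_fiber _ LI); apply/allP => y /mem_drop; apply: (allP lt_u).
  have lt_R : all (ltn^~ m) R.
    by rewrite (all_fiber _ RI); apply/allP => y /mem_take; apply: (allP lt_u).
  have szR : size R = k.
    move: RI; rewrite mem_fiber => /eqP ER.
    by rewrite -(perm_size (perm_revstack R)) ER size_takel.
  rewrite /= des_cat_max // -szR; case: R {lt_R RI szR} => [|y R] /=.
    by rewrite addn0 GRing.mul1r GRing.mulr1.
  by rewrite GRing.exprD GRing.exprS GRing.mulrCA.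
under eq_big_seq => k; first by rewrite mem_iota => kI; rewrite termE //; over.
rewrite -[size u]/(size u').+1 -addn1 iotaD big_cat /= big_cons big_seq1.
rewrite drop0 take0 -[(0 + _)%N]/(size u) drop_size take_size desgf_fiber_nil.
rewrite eqxx !GRing.mul1r GRing.mulr1 GRing.mulrDl GRing.mul1r -!GRing.addrA.
congr (_ + _)%R; rewrite GRing.addrC; congr (_ + _)%R.
by apply: eq_big_seq => -[|k]; rewrite mem_iota.
Qed.

Lemma gamma_positive_fiber u :
  uniq u -> gamma_positive (size u).-1 (desgf (fiber u)).
Proof.
have [n] := ubnP (size u); elim: n u => // n IH u.
case: (lastP u) => [_ _|{}u m].
  rewrite desgf_fiber_nil; exact: gamma_positive1.
rewrite size_rcons rcons_uniq => lt_n /andP[mu u_uniq] /=.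
have [lt_u|] := boolP (all (ltn^~ m) u); last first.
  (* The last letter of a word T(w) is the maximum of w. *)
  move/allPn=> [x xu nlt]; rewrite /desgf big_seq big_pred0 => [|w].
    exact: gamma_positive0.
  apply/negP; rewrite mem_fiber => /eqP Ew.
  have pw : perm_eq w (rcons u m) by rewrite -Ew perm_sym perm_revstack.
  have w_gt0 : 0 < size w by rewrite (perm_size pw) size_rcons.
  move: (Ew); rewrite revstackE // catA cats1 => /rcons_inj[_ Dm].
  have xw : x \in w by rewrite (perm_mem pw) mem_rcons inE xu orbT.
  have : x <= maxw w by apply: (leq_bigmax_seq (F := id)).
  rewrite Dm leqNgt => /negP[]; rewrite ltn_neqAle leqNgt nlt andbT.
  by apply: contraNneq mu => ->.
have [u0|u_gt0] := posnP (size u).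
  (* For empty u the cuts with L empty and with R empty are the same one, so
     the factor 1 + q would count it twice. *)
  have -> : fiber (rcons u m) = [:: [:: m]].
    by rewrite (size0nil u0) /fiber /= revstack_seq1 eqxx.
  by rewrite u0 /desgf big_seq1; exact: gamma_positive1.
rewrite desgf_fiber_rcons //; apply: gamma_positiveD.
  by rewrite -[size u]prednK //; apply/gamma_positive1X/IH.
apply: gamma_positive_sum => k; rewrite mem_iota add1n prednK //.
move=> /andP[k_gt0 k_lt] _.
have -> : size u = ((size (drop k u)).-1 + (size (take k u)).-1).+2.
  rewrite size_drop size_takel ?(ltnW k_lt) //.
  by rewrite -addnS prednK // -addSn prednK ?subn_gt0 // subnK // ltnW.
apply: gamma_positiveX; apply: gamma_positiveM; apply: IH.
- rewrite size_drop (leq_ltn_trans (leq_subr _ _)) //.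
- by rewrite drop_uniq.
- by rewrite size_takel ?(ltnW k_lt) // (ltn_trans k_lt).
- by rewrite take_uniq.
Qed.

(** * Unimodality *)

(** The factor T^t of T^(t+1) only sees the value of T, so the words are
    grouped by fibres of T. *)
Lemma v_succ t n i :
  v t.+1 n i =
  ((\sum_(u <- permutations (iota 1 n) | iter t revstack u == iota 1 n)
     desgf (fiber u))`_i)%R.
Proof.
set r := permutations (iota 1 n).
rewrite coef_sum big_seq_cond; under eq_bigr => u /andP[].
  rewrite mem_permutations => pu _; rewrite coef_desgf count_filter.
  rewrite (permP (perm_permutations pu)) -/r -sum1_count /=.
  over.
rewrite -big_seq_cond (exchange_big_dep (fun w => des w == i)) /=;
  last by move=> u w _ /andP[].
rewrite /v -/r -sum1_count big_mkcondr /=.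
rewrite big_seq_cond [RHS]big_seq_cond; apply: eq_bigr => w /andP[wr desw].
have Twr : revstack w \in r.
  by move: wr; rewrite !mem_permutations; apply: perm_trans (perm_revstack w).
rewrite -iterS iterSr sum1_count.
have E u : [&& iter t revstack u == iota 1 n, des w == i & revstack w == u]
    = (iter t revstack (revstack w) == iota 1 n) && (u == revstack w).
  by rewrite desw [u == _]eq_sym; case: (revstack w =P u) => [->|];
    rewrite ?andbF.
rewrite (eq_count E); case: eqP => _; last by rewrite count_pred0.
by rewrite count_uniq_mem ?permutations_uniq // Twr.
Qed.

Theorem theorem5p2 (n t : nat) (hn : 1 <= n) :
  unimodal [seq v t n i | i <- iota 0 n].
Proof.
case: t => [|t].
  have v0 i : v 0 n i.+1 = 0.
    apply/eqP; rewrite -leqn0 leqNgt -has_count; apply/hasPn => w _ /=.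
    by apply/negP => /andP[/eqP + /eqP wE]; rewrite wE des_iota.
  exists 0; first by rewrite size_map size_iota.
  rewrite drop0; split; first by case: n {v0} hn => //= n _; rewrite take0.
  apply/(sortedP 0) => i; rewrite size_map size_iota => lt_i.
  by rewrite /geq /= (nth_map 0) ?size_iota // nth_iota // v0.
rewrite (eq_map (v_succ t n)) -[n in iota 0 n]prednK //.
apply: gamma_positive_unimodal; apply: gamma_positive_sum => u.
rewrite mem_permutations => pu _.
rewrite -(size_iota 1 n) -(perm_size pu); apply: gamma_positive_fiber.
by rewrite (perm_uniq pu) iota_uniq.
Qed.
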